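(* Let $n\ge 2$, let $\mathbf{p}=(p_1,\ldots,p_n)\in[0,1]^n$ be arbitrary, and let $p$ be a real number with $0\le p\le\min_i p_i$ and $p<1$. Then there exists a random vector $\tilde{\mathbf{c}}=(\tilde c_1,\ldots,\tilde c_n)$ with values in $\{0,1\}^n$ such that $\mathbb{P}(\tilde c_i=1)=p_i$ for all $i\in\{1,\ldots,n\}$ and $$\mathbb{P}(\tilde c_i=1,\tilde c_j=1)=p_ip_j+\frac{p}{1-p}(1-p_i)(1-p_j)\qquad\text{for all }1\le i<j\le n.$$ *)

(* Defs.v *)
From HB Require Import structures.
From mathcomp Require Export all_boot all_order all_algebra.
From mathcomp Require Export all_classical all_reals all_analysis.

Set Implicit Arguments.
Unset Strict Implicit.
Unset Printing Implicit Defensive.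

(* Main.v *)
Require Import Defs.
From HB Require Import structures.
From mathcomp Require Import all_boot all_order all_algebra.
From mathcomp Require Import all_classical all_reals all_analysis.
From mathcomp Require Import ring.

(** The vector is a mixture of two laws.  With probability [p] all coordinates
    equal 1; with probability [1 - p] they are independent, coordinate [i]
    being Bernoulli of parameter [q i = (pv i - p) / (1 - p)], which lies
    between 0 and 1 because [p <= pv i <= 1] and [p < 1].  The coordinates indexed by
    any set [S] are then simultaneously 1 with probability
    [p + (1 - p) * \prod_(i in S) q i] (lemma [sum_mixture_pmf]).  For [S]
    empty this is the total mass 1, for a singleton it is [pv i], and for a
    pair it is
    [p + (pv i - p) * (pv j - p) / (1 - p)
       = pv i * pv j + p / (1 - p) * (1 - pv i) * (1 - pv j)].
    The mixture is realised on the space of bit tuples itself, as a finite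
    combination of point masses (lemma [discrete_probability]), with the
    identity as random vector. *)

Set Implicit Arguments.
Unset Strict Implicit.
Unset Printing Implicit Defensive.

Import Order.TTheory GRing.Theory Num.Theory.
Local Open Scope classical_set_scope.
Local Open Scope ring_scope.

(** Finitely many point masses of total weight 1 form a probability measure;
    the formula holds for every set [A], measurable or not. *)
Lemma discrete_probability (R : realType) d (T : measurableType d)
    (I : finType) (w : I -> R) (x : I -> T) :
  (forall i, 0 <= w i) -> \sum_i w i = 1 ->
  exists P : probability T R,
    forall A, P A = (\sum_i w i * (x i \in A)%:R)%:E.
Proof.
move=> w0 w1.
have [i0 _] : exists i0 : I, true.
  case: (pickP (@predT I)) => [i0 _|I0]; first by exists i0.
  by move: w1; rewrite big_pred0// => /eqP; rewrite eq_sym oner_eq0.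
pose e k := nth i0 (enum I) k.
pose m k : {measure set T -> \bar R} := mscale (NngNum (w0 (e k))) \d_(x (e k)).
pose mu : {measure set T -> \bar R} := msum m #|I|.
have muE A : mu A = (\sum_i w i * (x i \in A)%:R)%:E.
  rewrite /mu/= /msum -sumEFin [RHS]big_enum_val/=.
  apply: eq_bigr => k _.
  by rewrite /m/= /mscale/= diracE EFinM /e -(enum_val_nth i0).
have muT : mu setT = 1%E.
  rewrite muE -[RHS]/(1%:E) -[in RHS]w1; congr EFin; apply: eq_bigr => i _.
  by rewrite mem_set ?mulr1.
pose muP := Measure_isProbability.Build _ _ _ mu muT.
pose P : probability T R := HB.pack (Measure.sort mu) muP.
by exists P => A; rewrite -muE.
Qed.

Lemma natr_forall_in (R : comNzRingType) (I : finType) (S : pred I)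
    (f : I -> bool) :
  [forall i in S, f i]%:R = \prod_i (S i ==> f i)%:R :> R.
Proof.
case: (boolP [forall i in S, f i]) => [/forallP Sf|].
  by rewrite big1// => i _; rewrite Sf.
by rewrite negb_forall => /existsP[i /negbTE Sfi]; rewrite (bigD1 i)//= Sfi mul0r.
Qed.

(** Probability that independent bits take the value [f], the bit [i] being 1
    with probability [q i]. *)
Definition bernoulli_pmf (R : pzRingType) (I : finType) (q : I -> R)
    (f : {ffun I -> bool}) : R :=
  \prod_i (if f i then q i else 1 - q i).

(** Independent bits indexed by [S] are all 1 with probability the product of
    their parameters: the sum over [f] factors as a product over coordinates,
    whose factors outside [S] are [q i + (1 - q i) = 1]. *)
Lemma sum_bernoulli_pmf (R : comNzRingType) (I : finType) (q : I -> R)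
    (S : pred I) :
  \sum_f bernoulli_pmf q f * [forall i in S, f i]%:R = \prod_(i | S i) q i.
Proof.
under [LHS]eq_bigr => f _ do rewrite natr_forall_in -big_split/=.
rewrite -(bigA_distr_bigA
  (fun i b => (if b then q i else 1 - q i) * (S i ==> b)%:R))/=.
rewrite [RHS]big_mkcond/=; apply: eq_bigr => i _.
rewrite big_bool/= implybT mulr1.
by case: (S i); rewrite /= ?mulr0 ?addr0// mulr1 addrC subrK.
Qed.

(** Point masses of the mixture: all bits are 1 with probability [p], and they
    are independent with parameters [q i] with probability [1 - p]. *)
Definition mixture_pmf (R : pzRingType) (I : finType) (p : R) (q : I -> R)
    (f : {ffun I -> bool}) : R :=
  p * (f == [ffun=> true])%:R + (1 - p) * bernoulli_pmf q f.

Lemma mixture_pmf_ge0 (R : numDomainType) (I : finType) (p : R) (q : I -> R)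
    (f : {ffun I -> bool}) :
  0 <= p <= 1 -> (forall i, 0 <= q i <= 1) -> 0 <= mixture_pmf p q f.
Proof.
move=> /andP[p0 p1] q01; rewrite addr_ge0 ?mulr_ge0 ?subr_ge0//.
by apply: prodr_ge0 => i _; have /andP[? ?] := q01 i; case: ifP; rewrite ?subr_ge0.
Qed.

(** Probability, under the mixture, that all the bits indexed by [S] are 1. *)
Lemma sum_mixture_pmf (R : comNzRingType) (I : finType) (p : R) (q : I -> R)
    (S : pred I) :
  \sum_f mixture_pmf p q f * [forall i in S, f i]%:R =
  p + (1 - p) * \prod_(i | S i) q i.
Proof.
under [LHS]eq_bigr => f _ do rewrite mulrDl -!mulrA.
rewrite big_split/= -!mulr_sumr sum_bernoulli_pmf; congr (_ + _).
rewrite (bigD1 [ffun=> true])//= eqxx mul1r big1 => [|f /negbTE->]; last first.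
  by rewrite mul0r.
have -> : [forall i in S, [ffun=> true] i] by apply/forall_inP => i; rewrite ffunE.
by rewrite addr0 mulr1.
Qed.

Theorem corollary2p2 (R : realType) (n : nat) (hn : (2 <= n)%N)
    (pv : 'I_n -> R) (hpv : forall i, 0 <= pv i <= 1)
    (p : R) (hp0 : 0 <= p) (hpmin : forall i, p <= pv i) (hp1 : p < 1) :
  exists (d : measure_display) (T : measurableType d) (P : probability T R)
         (c : {RV P >-> n.-tuple bool}),
    (forall i : 'I_n, P [set w | tnth (c w) i = true] = (pv i)%:E) /\
    (forall i j : 'I_n, (i < j)%N ->
       P [set w | tnth (c w) i = true /\ tnth (c w) j = true] =
       (pv i * pv j + p / (1 - p) * (1 - pv i) * (1 - pv j))%:E).
Proof.
have p1_neq0 : 1 - p != 0 by rewrite subr_eq0 gt_eqF.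
pose q i := (pv i - p) / (1 - p).
have q01 i : 0 <= q i <= 1.
  have /andP[_ pv1] := hpv i.
  by rewrite divr_ge0 ?subr_ge0 ?(ltW hp1)// ler_pdivrMr ?subr_gt0// mul1r lerB.
pose x (f : {ffun 'I_n -> bool}) := [tuple f i | i < n].
have w0 f : 0 <= mixture_pmf p q f by rewrite mixture_pmf_ge0// hp0 ltW.
have w1 : \sum_f mixture_pmf p q f = 1.
  have := sum_mixture_pmf p q pred0; rewrite big_pred0// mulr1 addrC subrK => <-.
  by apply: eq_bigr => f _; rewrite (introT forall_inP) ?mulr1.
have [P PE] := discrete_probability x w0 w1.
(* Probability that the coordinates indexed by S are all 1. *)
have PS (S : pred 'I_n) (A : set (n.-tuple bool)) :
    (forall t, A t <-> forall i, S i -> tnth t i = true) ->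
    P A = (p + (1 - p) * \prod_(i | S i) q i)%:E.
  move=> AS; rewrite PE -sum_mixture_pmf; congr EFin; apply: eq_bigr => f _.
  congr (_ * _%:R); congr nat_of_bool.
  apply/idP/forall_inP => [|Sf]; rewrite inE AS.
    by move=> xf i /xf; rewrite tnth_mktuple.
  by move=> i /Sf; rewrite tnth_mktuple.
have mid : measurable_fun setT (@idfun (n.-tuple bool)) by exact: measurable_id.
pose idM := isMeasurableFun.Build _ _ _ _ (@idfun (n.-tuple bool)) mid.
pose c : {RV P >-> n.-tuple bool} := HB.pack (@idfun (n.-tuple bool)) idM.
exists _, _, P, c; split=> [i|i j ij].
  rewrite (PS (pred1 i)) => [|t]; last first.
    by split=> [ti k /eqP->//|]; apply; rewrite /= eqxx.
  by rewrite big_pred1_eq /q; congr EFin; field.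
have ji : j != i by apply: contraTneq ij => ->; rewrite ltnn.
rewrite (PS (pred2 i j)) => [|t]; last first.
  split=> [[ti tj] k /orP[]/eqP->//|tS].
  by split; apply: tS; rewrite /= eqxx ?orbT.
rewrite (bigD1 i)/= ?eqxx// (big_pred1 j) => [|k]; last first.
  by case: (eqVneq k i) => [->|]/=; rewrite ?(eq_sym i) ?(negbTE ji) ?andbT ?andbF.
by rewrite /q; congr EFin; field.
Qed.
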